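(* Let $\psi_{AB}$ be a pure bipartite state on $\mathcal{H}_A\otimes\mathcal{H}_B$, let $\rho:=\rho_B:=\operatorname{Tr}_A[\psi_{AB}]$, and let $k\ge 1$. Let $P_k$ be the $k\times k$ matrix with entries $(P_k)_{i,j}=\operatorname{Tr}[\rho^{\,i-j+1}]$ for $1\le j\le i\le k$, $(P_k)_{i,i+1}=i$ for $1\le i\le k-1$, and $(P_k)_{i,j}=0$ for $j>i+1$. Let $D_k$ be the $k\times k$ matrix with $(D_k)_{i,j}=\operatorname{Tr}[\rho^{\,i-j+1}]$ for $1\le j\le i\le k$, $(D_k)_{i,i+1}=-i$ for $1\le i\le k-1$, and $(D_k)_{i,j}=0$ for $j>i+1$. (In particular all diagonal entries of both matrices equal $\operatorname{Tr}[\rho]=1$.) Then the acceptance probability $p^{(k)}$ of the bipartite pure-state separability test satisfies $$p^{(k)}=\frac{1}{k!}\operatorname{perm}(P_k)=\frac{1}{k!}\det(D_k).$$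
   Context: $\mathcal{H}_A,\mathcal{H}_B$ are finite-dimensional complex Hilbert spaces; a pure state is a rank-one projection $|\psi\rangle\langle\psi|$ with $|\psi\rangle$ a unit vector, and $\operatorname{Tr}_A$ is the partial trace over $\mathcal{H}_A$. For $\pi\in S_k$, $W_{B_1\cdots B_k}(\pi)$ is the unitary on $\mathcal{H}_B^{\otimes k}$ permuting the tensor factors: $W_{B_1\cdots B_k}(\pi)(v_1\otimes\cdots\otimes v_k)=v_{\pi^{-1}(1)}\otimes\cdots\otimes v_{\pi^{-1}(k)}$. The acceptance probability of the bipartite pure-state separability test with $k$ copies is $$p^{(k)}:=\operatorname{Tr}[\Pi_{B_1\cdots B_k}\,\rho_B^{\otimes k}],\qquad \Pi_{B_1\cdots B_k}:=\frac{1}{k!}\sum_{\pi\in S_k}W_{B_1\cdots B_k}(\pi).$$ $\operatorname{perm}$ denotes the permanent of a square matrix. *)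

(* Defs.v *)
From mathcomp Require Import all_boot all_order all_fingroup all_algebra.
From mathcomp Require mxtens.
From mathcomp Require Export complex reals.
Set Implicit Arguments.
Unset Strict Implicit.
Unset Printing Implicit Defensive.
Import Order.TTheory GRing.Theory Num.Theory.
Local Open Scope ring_scope.
Local Open Scope sesquilinear_scope.

(* A d-dimensional Hilbert space is 'cV[C]_d with its standard orthonormal
   basis, and operators on it are matrices 'M[C]_d acting on the left.
   - H_A (x) H_B is 'cV[C]_(dA * dB) with the indexing
     mxtens.mxtens_index : 'I_dA * 'I_dB -> 'I_(dA * dB) of the Kronecker
     product mxtens.tensmx.
   - H_B ^(x)k is 'cV[C]_#|{ffun 'I_k -> 'I_d}|: the x-th basis vector is
     e_(f 0) (x) ... (x) e_(f (k-1)) with f = tens_label x. *)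

Definition permanent (R : pzSemiRingType) n (A : 'M[R]_n) : R :=
  \sum_(s : 'S_n) \prod_i A i (s i).

Section Tensor.
Variable C : numClosedFieldType.

Definition unit_vector n (psi : 'cV[C]_n) : Prop := psi ^t* *m psi = 1%:M.

Definition pure_state n (Psi : 'M[C]_n) : Prop :=
  exists2 psi : 'cV[C]_n, unit_vector psi & Psi = psi *m psi ^t*.

Definition ptraceA dA dB (X : 'M[C]_(dA * dB)) : 'M[C]_dB :=
  \matrix_(i, j) \sum_(a < dA)
    X (mxtens.mxtens_index (a, i)) (mxtens.mxtens_index (a, j)).

Definition tens_dim k d : nat := #|{ffun 'I_k -> 'I_d}|.

Definition tens_label k d (x : 'I_(tens_dim k d)) : {ffun 'I_k -> 'I_d} :=
  enum_val x.

Definition tensv k d (v : 'I_k -> 'cV[C]_d) : 'cV[C]_(tens_dim k d) :=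
  \col_x \prod_(i < k) v i (tens_label x i) 0.

Definition tens_pow k d (A : 'M[C]_d) : 'M[C]_(tens_dim k d) :=
  \matrix_(x, y) \prod_(i < k) A (tens_label x i) (tens_label y i).

(* The unitary sending the basis vector indexed by f to the one indexed by
   f o pi^-1; see permW_tensv for its action on product vectors. *)
Definition permW k d (pi : 'S_k) : 'M[C]_(tens_dim k d) :=
  \matrix_(x, y)
    (tens_label x == [ffun i => tens_label y ((pi^-1)%g i)])%:R.

Definition sym_proj k d : 'M[C]_(tens_dim k d) :=
  (k`!%:R)^-1 *: \sum_(pi : 'S_k) permW d pi.

Definition accept_prob k dA dB (PsiAB : 'M[C]_(dA * dB)) : C :=
  \tr (sym_proj k dB *m tens_pow k (ptraceA PsiAB)).

(* Ordinals start at 0, so the superdiagonal entry i of the 1-based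
   convention is i.+1 below. *)
Definition permMx k d (rho : 'M[C]_d) : 'M[C]_k :=
  \matrix_(i, j)
    if (j <= i)%N then \tr (rho ^+ (i - j).+1)
    else if j == i.+1 :> nat then (i.+1)%:R else 0.

Definition detMx k d (rho : 'M[C]_d) : 'M[C]_k :=
  \matrix_(i, j)
    if (j <= i)%N then \tr (rho ^+ (i - j).+1)
    else if j == i.+1 :> nat then - (i.+1)%:R else 0.

Lemma ptraceA_tens dA dB (A : 'M[C]_dA) (B : 'M[C]_dB) :
  ptraceA (mxtens.tensmx A B) = \tr A *: B.
Proof.
apply/matrixP=> i j; rewrite !mxE mulr_suml.
by apply: eq_bigr => a _; rewrite mxtens.tensmxE.
Qed.

Lemma tens_label_bij k d : bijective (@tens_label k d).
Proof. exact: enum_val_bij. Qed.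

Lemma permW_tensv k d (pi : 'S_k) (v : 'I_k -> 'cV[C]_d) :
  permW d pi *m tensv v = tensv (fun i => v ((pi^-1)%g i)).
Proof.
have [g gK Kg] := tens_label_bij k d.
apply/matrixP=> x z; rewrite !mxE.
pose f : {ffun 'I_k -> 'I_d} := [ffun i => tens_label x (pi i)].
rewrite (bigD1 (g f)) //= !mxE [X in _ + X]big1 ?addr0 => [|y ne_y].
  rewrite Kg; have -> : tens_label x = [ffun i => f ((pi^-1)%g i)].
    by apply/ffunP=> i; rewrite !ffunE permKV.
  rewrite eqxx mul1r [LHS](reindex_inj (@perm_inj _ pi^-1%g)) /=.
  by apply: eq_bigr => i _; rewrite !ffunE !permKV.
rewrite !mxE; case: eqP => [ex|_]; last by rewrite mul0r.
case/eqP: ne_y; rewrite -[y]gK; congr g.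
by apply/ffunP=> i; rewrite ffunE ex ffunE permK.
Qed.

Lemma tens_pow_tensv k d (A : 'M[C]_d) (v : 'I_k -> 'cV[C]_d) :
  tens_pow k A *m tensv v = tensv (fun i => A *m v i).
Proof.
apply/matrixP=> x z; rewrite !mxE.
under [RHS]eq_bigr do rewrite mxE.
rewrite (bigA_distr_bigA (fun i j => A (tens_label x i) j * v i j 0)) /=.
rewrite (reindex (@tens_label k d)) /=; last exact/onW_bij/tens_label_bij.
by apply: eq_bigr => f _; rewrite !mxE -big_split.
Qed.

Lemma tr_ptraceA dA dB (X : 'M[C]_(dA * dB)) : \tr (ptraceA X) = \tr X.
Proof.
rewrite /mxtrace; under eq_bigr do rewrite mxE.
rewrite exchange_big pair_big [RHS](reindex (@mxtens.mxtens_index dA dB)) /=.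
  by apply: eq_bigr => -[].
by exists (@mxtens.mxtens_unindex dA dB) => ? _;
  rewrite (mxtens.mxtens_indexK, mxtens.mxtens_unindexK).
Qed.

Lemma tr_pure_state n (Psi : 'M[C]_n) : pure_state Psi -> \tr Psi = 1.
Proof. by case=> psi u ->; rewrite mxtrace_mulC u mxtrace1. Qed.

Lemma permMx_diag k dA dB (Psi : 'M[C]_(dA * dB)) (i : 'I_k) :
  pure_state Psi -> permMx k (ptraceA Psi) i i = 1.
Proof. by move=> u; rewrite mxE leqnn subnn expr1 tr_ptraceA tr_pure_state. Qed.

Lemma detMx_diag k dA dB (Psi : 'M[C]_(dA * dB)) (i : 'I_k) :
  pure_state Psi -> detMx k (ptraceA Psi) i i = 1.
Proof. by move=> u; rewrite mxE leqnn subnn expr1 tr_ptraceA tr_pure_state. Qed.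

End Tensor.

(* Main.v *)
Require Import Defs.
From mathcomp Require Import all_boot all_order all_fingroup all_algebra.
From mathcomp Require Import complex reals.
Set Implicit Arguments.
Unset Strict Implicit.
Unset Printing Implicit Defensive.
Import GRing.Theory.
Local Open Scope ring_scope.
Local Open Scope complex_scope.

(** Let T_n(X) be the sum over s in S_(n+1) of Tr[W(s) (X (x) rho (x) ... (x) rho)].
    Removing from s the slot that carries X gives
      T_(n+1)(X) = Tr[X] T_n(rho) + (n+1) T_n(rho X),
    the last term coming from the n+1 possible predecessors of that slot.
    The permanent of the Hessenberg matrix P whose last row is replaced by
    j |-> Tr[X rho^(n-j)] satisfies the same recursion, by expansion along the
    last column, which has only two nonzero entries. For the determinant the
    cofactor sign of the superdiagonal entry cancels its minus sign. *)

(** Such an [s] amounts to the bijection it induces between the complements of [i] and [j]; [g s] is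
    that bijection read on ['I_n]. *)
Lemma big_lift_perm (R : pzSemiRingType) n (i j : 'I_n.+1) (F : 'S_n.+1 -> R) :
  \sum_(s : 'S_n.+1 | s i == j) F s = \sum_(s : 'S_n) F (lift_perm i j s).
Proof.
(* The default [k] is never reached: injectivity gives [s (lift i k) != s i]. *)
pose g (s : 'S_n.+1) k := odflt k (unlift (s i) (s (lift i k))).
have gK (s : 'S_n.+1) k : lift (s i) (g s k) = s (lift i k).
  rewrite /g; case: unliftP => [//|/perm_inj e].
  by have := neq_lift i k; rewrite e eqxx.
have g_inj s : injective (g s).
  by move=> k l e; apply/(@lift_inj _ i)/(@perm_inj _ s); rewrite -!gK e.
rewrite (reindex (lift_perm i j)).
  by apply: eq_bigl => s; rewrite lift_perm_id eqxx.
exists (fun s => perm (g_inj s)) => [s _|s /eqP si].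
  apply/permP=> k; apply: (@lift_inj _ j).
  by rewrite permE -{1}(lift_perm_id i j s) gK lift_perm_lift.
apply/permP=> k; case: (unliftP i k) => [l|] ->; last by rewrite lift_perm_id.
by rewrite lift_perm_lift -si permE gK.
Qed.

(** The permutations are grouped by the row that they send to [j]. *)
Lemma expand_permanent_col (R : comPzSemiRingType) n (A : 'M[R]_n.+1)
    (j : 'I_n.+1) :
  permanent A = \sum_i A i j * permanent (row' i (col' j A)).
Proof.
rewrite /permanent (partition_big (fun s : 'S_n.+1 => (s^-1)%g j) predT) //=.
apply: eq_bigr => i _.
rewrite (eq_bigl (fun s : 'S_n.+1 => s i == j)); last first.
  by move=> s; rewrite -(inj_eq (@perm_inj _ s)) permKV eq_sym.
rewrite big_lift_perm mulr_sumr; apply: eq_bigr => s _.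
rewrite (bigD1_ord i) //= lift_perm_id; congr (_ * _).
by apply: eq_bigr => k _; rewrite lift_perm_lift !mxE.
Qed.

(* The last row is left free, so that the family is stable under expansion
   along the last column. *)
Definition hessenberg (R : pzRingType) (c : R) (p r : nat -> R) n : 'M[R]_n.+1 :=
  \matrix_(i, j)
    if i == n :> nat then r j
    else if (j <= i)%N then p (i - j).+1
    else if j == i.+1 :> nat then c * (i.+1)%:R else 0.

Lemma hessenberg_minor_last (R : pzRingType) (c : R) (p r : nat -> R) n :
  row' ord_max (col' ord_max (hessenberg c p r n.+1)) =
  hessenberg c p (fun j => p (n - j).+1) n.
Proof.
apply/matrixP=> i j; rewrite !mxE !lift_max.
have := ltn_ord i; have := ltn_ord j; rewrite !ltnS => jn i_n.
rewrite (ltn_eqF (leq_ltn_trans i_n _)) //.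
by case: (nat_of_ord i =P n) => [->|//]; rewrite jn.
Qed.

(** Once row [n] is gone, the free row moves up into its place, so [r] survives unchanged. *)
Lemma hessenberg_minor_prelast (R : pzRingType) (c : R) (p r : nat -> R) n :
  row' (inord n) (col' ord_max (hessenberg c p r n.+1)) =
  hessenberg c p r n.
Proof.
apply/matrixP=> i j; rewrite !mxE /= inordK //.
rewrite (_ : bump n.+1 j = j); last by rewrite /bump leqNgt ltn_ord.
rewrite /bump; have := ltn_ord i; rewrite ltnS leq_eqVlt => /orP[/eqP ->|i_n].
  by rewrite leqnn add1n !eqxx.
by rewrite leqNgt i_n add0n (ltn_eqF i_n) ltn_eqF // (ltn_trans i_n).
Qed.

(** [F] is arbitrary so as to serve for both permanental minors and cofactors. *)
Lemma sum_hessenberg_last_col (R : pzRingType) (c : R) (p r : nat -> R) n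
    (F : 'I_n.+2 -> R) :
  \sum_i hessenberg c p r n.+1 i ord_max * F i =
  r n.+1 * F ord_max + c * n.+1%:R * F (inord n).
Proof.
rewrite big_ord_recr /= mxE /= eqxx addrC; congr (_ + _).
rewrite big_ord_recr big1 => [|i _] /=.
  rewrite add0r mxE /= ltn_eqF // ltnn eqxx; congr (_ * F _).
  by apply: val_inj; rewrite /= inordK.
have i_n := ltn_ord i; rewrite mxE /= ltn_eqF; last exact: ltnW.
by rewrite leqNgt ltnS (ltnW i_n) /= eqSS gtn_eqF ?mul0r.
Qed.

Lemma permanent_hessenbergS (R : comPzRingType) (c : R) (p r : nat -> R) n :
  permanent (hessenberg c p r n.+1) =
  r n.+1 * permanent (hessenberg c p (fun j => p (n - j).+1) n) +
  c * n.+1%:R * permanent (hessenberg c p r n).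
Proof.
rewrite (expand_permanent_col _ ord_max) sum_hessenberg_last_col.
by rewrite hessenberg_minor_last hessenberg_minor_prelast.
Qed.

Lemma det_hessenbergS (R : comPzRingType) (c : R) (p r : nat -> R) n :
  \det (hessenberg c p r n.+1) =
  r n.+1 * \det (hessenberg c p (fun j => p (n - j).+1) n) -
  c * n.+1%:R * \det (hessenberg c p r n).
Proof.
rewrite (expand_det_col _ ord_max) sum_hessenberg_last_col /cofactor.
rewrite hessenberg_minor_last hessenberg_minor_prelast /=.
(* The two cofactor signs are (-1)^(2n+2) = 1 and (-1)^(2n+1) = -1. *)
rewrite addnn -signr_odd odd_double mul1r inordK // addnS addnn exprS.
by rewrite -signr_odd odd_double mulr1 mulN1r mulrN.
Qed.

(** Replacing [c] by [- c] turns one recursion into the other. The induction keeps [r] general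
    because one of the minors changes the last row. *)
Lemma permanent_hessenberg (R : comPzRingType) (c : R) (p r : nat -> R) n :
  permanent (hessenberg c p r n) = \det (hessenberg (- c) p r n).
Proof.
elim: n r => [|n IH] r.
  rewrite det_mx11 /permanent (big_pred1 1%g) => [|s].
    by rewrite big_ord1 perm1 !mxE.
  by apply/esym/eqP/permP=> i; rewrite !ord1.
by rewrite permanent_hessenbergS det_hessenbergS !IH !mulNr opprK.
Qed.

(* [\tr (W(s) *m (A 0 (x) ... (x) A (k-1)))] up to inversion of [s]. *)
Definition perm_trace (R : comPzRingType) d k (A : 'I_k -> 'M[R]_d) (s : 'S_k) :
    R :=
  \sum_(f : {ffun 'I_k -> 'I_d}) \prod_i A i (f i) (f (s i)).

Lemma eq_perm_trace (R : comPzRingType) d k (A B : 'I_k -> 'M[R]_d) s :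
  A =1 B -> perm_trace A s = perm_trace B s.
Proof.
by move=> e; apply: eq_bigr => f _; apply: eq_bigr => i _; rewrite e.
Qed.

(** Conjugation by [t] only renames the slots, which the substitution of [f] o [t^-1] for [f]
    undoes. *)
Lemma perm_traceJ (R : comPzRingType) d k (A : 'I_k -> 'M[R]_d) (s t : 'S_k) :
  perm_trace A (s ^ t)%g = perm_trace (fun i => A (t i)) s.
Proof.
rewrite /perm_trace.
rewrite (reindex_inj (h := fun f : {ffun 'I_k -> 'I_d} => [ffun i => f (t^-1 i)%g])).
  apply: eq_bigr => f _; rewrite (reindex_inj (@perm_inj _ t)) /=.
  by apply: eq_bigr => i _; rewrite !ffunE permJ !permK.
move=> f g /ffunP e; apply/ffunP=> i.
by have := e (t i); rewrite !ffunE permK.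
Qed.

Lemma big_ffun_ord_recl (R : pzRingType) d n
    (F : {ffun 'I_n.+1 -> 'I_d} -> R) :
  \sum_f F f =
  \sum_a \sum_(f : {ffun 'I_n -> 'I_d})
    F [ffun i => oapp f a (unlift ord0 i)].
Proof.
rewrite pair_big /=.
rewrite (reindex (fun u : 'I_d * {ffun 'I_n -> 'I_d} =>
  [ffun i => oapp u.2 u.1 (unlift ord0 i)])) //=.
exists (fun f : {ffun 'I_n.+1 -> 'I_d} => (f ord0, [ffun i => f (lift ord0 i)])).
  case=> a f _; rewrite ffunE unlift_none /=; congr (_, _).
  by apply/ffunP=> i; rewrite !ffunE liftK.
move=> f _; apply/ffunP=> i; rewrite ffunE.
by case: unliftP => [j|] -> //=; rewrite ffunE.
Qed.

(** A fixed slot is a cycle of its own, so its label is summed independently. *)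
Lemma perm_trace_lift0 (R : comPzRingType) d n (A : 'I_n.+1 -> 'M[R]_d)
    (s : 'S_n) :
  perm_trace A (lift_perm ord0 ord0 s) =
  \tr (A ord0) * perm_trace (fun i => A (lift ord0 i)) s.
Proof.
rewrite {1}/perm_trace big_ffun_ord_recl mulr_suml; apply: eq_bigr => a _.
rewrite mulr_sumr; apply: eq_bigr => f _.
rewrite big_ord_recl lift_perm_id !ffunE unlift_none /=; congr (_ * _).
by apply: eq_bigr => i _; rewrite lift_perm_lift !ffunE !liftK.
Qed.

(* Summing over the label at 0 contracts the arc [i -> 0 -> s i] of the
   permutation to [i -> s i]. *)
Lemma perm_trace_contract0 (R : comPzRingType) d n (A : 'I_n.+1 -> 'M[R]_d)
    (i : 'I_n) (s : 'S_n) :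
  perm_trace A (tperm (lift ord0 i) ord0 * lift_perm ord0 ord0 s)%g =
  perm_trace
    (fun j => if j == i then A (lift ord0 i) *m A ord0 else A (lift ord0 j)) s.
Proof.
rewrite {1}/perm_trace big_ffun_ord_recl exchange_big; apply: eq_bigr => f _ /=.
rewrite [RHS](bigD1 i) //= eqxx mxE mulr_suml; apply: eq_bigr => a _.
rewrite big_ord_recl (bigD1 i) //= mulrA; congr (_ * _).
  rewrite !permM tpermR tpermL lift_perm_lift lift_perm_id !ffunE.
  by rewrite unlift_none !liftK mulrC.
apply: eq_bigr => j ji; rewrite (negPf ji) permM tpermD ?neq_lift //.
  by rewrite lift_perm_lift !ffunE !liftK.
by rewrite (inj_eq lift_inj) eq_sym.
Qed.

(** The permutations are sorted by the preimage of [ord0]; a transposition moves that preimage to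
    [ord0], and is trivial in the first sum. *)
Lemma sum_perm_recl (R : pzRingType) n (F : 'S_n.+1 -> R) :
  \sum_s F s =
  \sum_(s : 'S_n) F (lift_perm ord0 ord0 s) +
  \sum_(i < n) \sum_(s : 'S_n)
    F (tperm (lift ord0 i) ord0 * lift_perm ord0 ord0 s)%g.
Proof.
have part i : \sum_(s : 'S_n.+1 | (s^-1)%g ord0 == i) F s =
    \sum_(s : 'S_n) F (tperm i ord0 * lift_perm ord0 ord0 s)%g.
  rewrite (reindex_inj (mulgI (tperm i ord0))).
  rewrite -(big_lift_perm _ _ (fun s => F (tperm i ord0 * s)%g)) /=.
  apply: eq_bigl => s.
  by rewrite -(inj_eq (@perm_inj _ (tperm i ord0 * s))) permKV permM tpermL eq_sym.
rewrite (partition_big (fun s : 'S_n.+1 => (s^-1)%g ord0) predT) //=.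
rewrite big_ord_recl part; congr (_ + _); last by apply: eq_bigr => i _; rewrite part.
by apply: eq_bigr => s _; rewrite tperm1 mul1g.
Qed.

Lemma sum_perm_trace_hessenberg (R : comPzRingType) d n (rho X : 'M[R]_d) :
  \sum_(s : 'S_n.+1)
    perm_trace (fun i => if i == ord0 then X else rho) s =
  permanent (hessenberg 1 (fun m => \tr (rho ^+ m))
    (fun j => \tr (X *m rho ^+ (n - j))) n).
Proof.
(* Conjugation by [tperm i ord0] permutes the whole group, so the slot holding [Y] is immaterial;
   hence all contractions contribute equally. *)
have sum_slot m (i : 'I_m.+1) (Y : 'M[R]_d) :
    \sum_(s : 'S_m.+1) perm_trace (fun j => if j == i then Y else rho) s =
    \sum_(s : 'S_m.+1) perm_trace (fun j => if j == ord0 then Y else rho) s.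
  rewrite [RHS](reindex_inj (h := fun s : 'S_m.+1 => (s ^ tperm i ord0)%g)) /=;
    last exact: conjg_inj.
  apply: eq_bigr => s _; rewrite perm_traceJ; apply: eq_perm_trace => j.
  by rewrite -(inj_eq (@perm_inj _ (tperm i ord0))) tpermL.
elim: n X => [|n IH] X.
  rewrite (big_pred1 1%g) => [|s]; last first.
    by apply/esym/eqP/permP=> i; rewrite !ord1.
  rewrite permanent_hessenberg det_mx11 mxE /= subnn expr0 mulmx1.
  rewrite /perm_trace big_ffun_ord_recl; apply: eq_bigr => a _.
  rewrite (big_pred1 [ffun i : 'I_0 => a]) => [|f].
    by rewrite big_ord1 perm1 !ffunE unlift_none.
  by apply/esym/eqP/ffunP; case.
rewrite sum_perm_recl permanent_hessenbergS; congr (_ + _).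
  under eq_bigr do rewrite perm_trace_lift0 /=.
  rewrite -mulr_sumr subnn expr0 mulmx1; congr (_ * _).
  (* The constant family is the instance [X := rho] of the induction hypothesis. *)
  transitivity (\sum_(s : 'S_n.+1)
    perm_trace (fun i => if i == ord0 then rho else rho) s).
    by apply: eq_bigr => s _; apply: eq_perm_trace => i; rewrite if_same.
  rewrite IH; congr (permanent _); apply/matrixP=> i j; rewrite !mxE.
  by case: eqP => // _; rewrite exprS.
(* The factor n+1 becomes a sum over the possible predecessors of slot [ord0]. *)
rewrite mul1r mulr_natl -[X in _ *+ X]card_ord -sumr_const.
apply: eq_bigr => i _; under eq_bigr do rewrite perm_trace_contract0.
transitivity (\sum_(s : 'S_n.+1)
  perm_trace (fun j => if j == i then rho *m X else rho) s).
  by apply: eq_bigr => s _; apply: eq_perm_trace => j.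
rewrite sum_slot IH.
congr (permanent _); apply/matrixP=> a b; rewrite !mxE.
(* By cyclicity Tr[rho X rho^(n-b)] = Tr[X rho^(n+1-b)], where b <= n. *)
case: eqP => // _; rewrite subSn ?leq_ord // -mulmxA mxtrace_mulC -mulmxA.
by rewrite exprSr.
Qed.

Lemma accept_prob_perm_trace (C : numClosedFieldType) k dA dB
    (Psi : 'M[C]_(dA * dB)) :
  accept_prob k Psi =
  (k`!%:R)^-1 * \sum_(s : 'S_k) perm_trace (fun=> ptraceA Psi) s.
Proof.
rewrite /accept_prob /sym_proj -scalemxAl mxtraceZ mulmx_suml raddf_sum /=.
(* Inverting [s] matches the [pi^-1] in [permW]. *)
congr (_ * _); rewrite [RHS](reindex_inj invg_inj); apply: eq_bigr => s _.
rewrite /perm_trace /mxtrace.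
under eq_bigr do rewrite mxE.
rewrite exchange_big /= (reindex (@tens_label k dB)) /=; last first.
  exact/onW_bij/tens_label_bij.
have [g gK Kg] := tens_label_bij k dB.
apply: eq_bigr => y _.
(* Column [y] of the permutation matrix has a single nonzero entry, at the label of [y] composed
   with [s^-1]. *)
rewrite (bigD1 (g [ffun i => tens_label y (s^-1%g i)])) //= big1 => [|x ne_x].
  rewrite !mxE Kg eqxx mul1r addr0.
  by apply: eq_bigr => i _; rewrite ffunE.
rewrite !mxE; case: eqP => [ex|_]; last by rewrite mul0r.
by case/eqP: ne_x; rewrite -ex gK.
Qed.

Lemma hessenberg_trace (R : pzRingType) d n (c : R) (rho : 'M[R]_d) :
  hessenberg c (fun m => \tr (rho ^+ m)) (fun j => \tr (rho *m rho ^+ (n - j))) n =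
  \matrix_(i, j)
    if (j <= i)%N then \tr (rho ^+ (i - j).+1)
    else if j == i.+1 :> nat then c * (i.+1)%:R else 0.
Proof.
apply/matrixP=> i j; rewrite !mxE; case: eqP => // ->.
by rewrite leq_ord exprS.
Qed.

Theorem mainTheorem2 (R : realType) (dA dB k : nat) (hk : (1 <= k)%N)
    (PsiAB : 'M[R[i]]_(dA * dB)) (hPsi : pure_state PsiAB) :
  let rho : 'M[R[i]]_dB := ptraceA PsiAB in
  accept_prob k PsiAB = (k`!%:R)^-1 * permanent (permMx k rho) /\
  (k`!%:R)^-1 * permanent (permMx k rho) = (k`!%:R)^-1 * \det (detMx k rho).
Proof.
move=> rho; case: k hk => [//|n _].
have permE : permMx n.+1 rho = hessenberg 1 (fun m => \tr (rho ^+ m))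
    (fun j => \tr (rho *m rho ^+ (n - j))) n.
  by rewrite hessenberg_trace; apply/matrixP=> i j; rewrite !mxE mul1r.
have detE : detMx n.+1 rho = hessenberg (- 1) (fun m => \tr (rho ^+ m))
    (fun j => \tr (rho *m rho ^+ (n - j))) n.
  by rewrite hessenberg_trace; apply/matrixP=> i j; rewrite !mxE mulN1r.
split; last by rewrite permE detE permanent_hessenberg.
rewrite accept_prob_perm_trace permE -sum_perm_trace_hessenberg.
congr (_ * _); apply: eq_bigr => s _; apply: eq_perm_trace => i.
by rewrite if_same.
Qed.
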